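(* $\mathsf{iSL}_{\mathsf a}$ proves the strong uniqueness principle $\mathsf{sU}$: for every propositional variable $r$, every formula $\chi$ modalised in $r$, and all formulas $\phi,\psi$, $$\mathsf{iSL}_{\mathsf a}\vdash\big((\phi\leftrightarrow\chi[r:\phi])\wedge(\psi\leftrightarrow\chi[r:\psi])\big)\to(\phi\leftrightarrow\psi).$$
   Context: Formulas of $\mathbb L(\rightsquigarrow)$ are built from propositional variables, $\top,\bot$, and binary connectives $\wedge,\vee,\to,\rightsquigarrow$. Abbreviations: $(\phi\leftrightarrow\psi):=((\phi\to\psi)\wedge(\psi\to\phi))$ and $\Box\phi:=(\top\rightsquigarrow\phi)$. $\chi[r:\phi]$ denotes the result of substituting $\phi$ for $r$ in $\chi$. A formula $\chi$ is modalised in $r$ if every occurrence of $r$ in $\chi$ is in the scope of an occurrence of $\rightsquigarrow$. The system $\mathsf{HLC}^\sharp$ is axiomatised by all axioms and rules of intuitionistic propositional logic, the rule: from $\vdash\phi\to\psi$ infer $\vdash\phi\rightsquigarrow\psi$, and the axiom schemes $((\phi\rightsquigarrow\psi)\wedge(\psi\rightsquigarrow\chi))\to(\phi\rightsquigarrow\chi)$, $((\phi\rightsquigarrow\psi)\wedge(\phi\rightsquigarrow\chi))\to(\phi\rightsquigarrow(\psi\wedge\chi))$, $((\phi\rightsquigarrow\chi)\wedge(\psi\rightsquigarrow\chi))\to((\phi\vee\psi)\rightsquigarrow\chi)$. $\mathsf{iSL}_{\mathsf a}$ is $\mathsf{HLC}^\sharp$ plus the axiom scheme $(\Box\phi\to\phi)\to\phi$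 (all rules applying to the extended system). *)

(* Defs.v *)
From Stdlib Require Import PeanoNat.

Inductive form : Type :=
| Var (p : nat)
| Top
| Bot
| And (A B : form)
| Or (A B : form)
| Imp (A B : form)
| Strict (A B : form).

Declare Scope form_scope.
Delimit Scope form_scope with form.
Bind Scope form_scope with form.

Notation "A ⩑ B" := (And A B) (at level 40, left associativity) : form_scope.
Notation "A ⩒ B" := (Or A B) (at level 50, left associativity) : form_scope.
Notation "A ~> B" := (Strict A B) (at level 55, no associativity) : form_scope.
Notation "A ⟶ B" := (Imp A B) (at level 60, right associativity) : form_scope.

Definition Iff (A B : form) : form := ((A ⟶ B) ⩑ (B ⟶ A))%form.
Notation "A ⟷ B" := (Iff A B) (at level 65, no associativity) : form_scope.

Definition Box (A : form) : form := (Top ~> A)%form.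
Notation "□ A" := (Box A) (at level 30, right associativity) : form_scope.

Fixpoint subst (r : nat) (A : form) (C : form) : form :=
  match C with
  | Var p => if Nat.eqb p r then A else Var p
  | Top => Top
  | Bot => Bot
  | And C1 C2 => And (subst r A C1) (subst r A C2)
  | Or C1 C2 => Or (subst r A C1) (subst r A C2)
  | Imp C1 C2 => Imp (subst r A C1) (subst r A C2)
  | Strict C1 C2 => Strict (subst r A C1) (subst r A C2)
  end.
Notation "C [ r : A ]" := (subst r A C)
  (at level 2, left associativity, r at level 99, A at level 99,
   format "C [ r :  A ]") : form_scope.

Fixpoint modalised (r : nat) (C : form) : Prop :=
  match C with
  | Var p => p <> r
  | Top | Bot => True
  | And C1 C2 | Or C1 C2 | Imp C1 C2 => modalised r C1 /\ modalised r C2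
  | Strict _ _ => True
  end.

Open Scope form_scope.

(* Axiom schemes of intuitionistic propositional logic; its only rule, modus
   ponens, is [MP] below. *)
Inductive IPC_axiom : form -> Prop :=
| IPC_K A B : IPC_axiom (A ⟶ B ⟶ A)
| IPC_S A B C : IPC_axiom ((A ⟶ B ⟶ C) ⟶ (A ⟶ B) ⟶ A ⟶ C)
| IPC_andI A B : IPC_axiom (A ⟶ B ⟶ A ⩑ B)
| IPC_andE1 A B : IPC_axiom (A ⩑ B ⟶ A)
| IPC_andE2 A B : IPC_axiom (A ⩑ B ⟶ B)
| IPC_orI1 A B : IPC_axiom (A ⟶ A ⩒ B)
| IPC_orI2 A B : IPC_axiom (B ⟶ A ⩒ B)
| IPC_orE A B C : IPC_axiom ((A ⟶ C) ⟶ (B ⟶ C) ⟶ A ⩒ B ⟶ C)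
| IPC_botE A : IPC_axiom (Bot ⟶ A)
| IPC_topI : IPC_axiom Top.

Inductive strict_axiom : form -> Prop :=
| strict_trans A B C : strict_axiom ((A ~> B) ⩑ (B ~> C) ⟶ (A ~> C))
| strict_and A B C : strict_axiom ((A ~> B) ⩑ (A ~> C) ⟶ (A ~> B ⩑ C))
| strict_or A B C : strict_axiom ((A ~> C) ⩑ (B ~> C) ⟶ (A ⩒ B ~> C)).

(* [HLCsharp_plus X] is the system HLC♯ extended with the axioms [X]; both
   rules apply to every theorem of the extended system. *)
Inductive HLCsharp_plus (X : form -> Prop) : form -> Prop :=
| ax_IPC A : IPC_axiom A -> HLCsharp_plus X A
| ax_strict A : strict_axiom A -> HLCsharp_plus X A
| ax_extra A : X A -> HLCsharp_plus X A
| MP A B : HLCsharp_plus X (A ⟶ B) -> HLCsharp_plus X A -> HLCsharp_plus X B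
| Nec A B : HLCsharp_plus X (A ⟶ B) -> HLCsharp_plus X (A ~> B).

Definition HLCsharp : form -> Prop := HLCsharp_plus (fun _ => False).

Inductive strong_Loeb_axiom : form -> Prop :=
| strong_Loeb A : strong_Loeb_axiom ((□ A ⟶ A) ⟶ A).

Definition iSLa : form -> Prop := HLCsharp_plus strong_Loeb_axiom.

(* Main.v *)
Require Import Defs.
From Stdlib Require Import PeanoNat.

(** Write [E] for [phi ⟷ psi] and [H] for the conjunction of the two fixed-point
    equations.  By the strong Löb axiom for [E], it is enough to derive [E] from
    [H] and [□ E].  Since [phi] and [psi] are equivalent to [chi[r : phi]] and
    [chi[r : psi]] under [H], what has to be seen is that [□ E] already makes the
    latter two equivalent ([subst_modalised_mono]).

    As [chi] is modalised in [r], it is an intuitionistic combination of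
    formulas without [r] and formulas [A ~> B], so that only the latter matter.
    From [□ (A' ⟶ A)] and [□ (B ⟶ B')] one gets [(A ~> B) ⟶ (A' ~> B')]
    ([strict_mono]), and these boxed implications come from [□ E] as soon as
    [E] itself proves that substituting [phi] or [psi] into an arbitrary formula
    gives equivalent results ([subst_mono]).  Below a [~>] this replacement
    principle again asks for [□ E] instead of [E]; the strong Löb axiom supplies
    it, because it yields completeness, [A ⟶ □ A] ([completeness]).

    Every derivation is carried out under a single formula that plays the role of
    the context.  Replacing [phi] by [psi] is shown one implication at a time, for
    all [phi] and [psi] simultaneously, so that the contravariant positions are
    handled by exchanging the two. *)

Notation "G ⊢[ X ] A" := (HLCsharp_plus X (G ⟶ A))
  (at level 70, X at level 0, no associativity).

(** * Intuitionistic reasoning under one hypothesis *)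

Lemma entails_theorem X G A : HLCsharp_plus X A -> G ⊢[X] A.
Proof.
  intros HA. eapply MP; [|exact HA]. apply ax_IPC, IPC_K.
Qed.

Lemma entails_mp X G A B : G ⊢[X] (A ⟶ B) -> G ⊢[X] A -> G ⊢[X] B.
Proof.
  intros HAB HA. eapply MP; [|exact HA]. eapply MP; [|exact HAB].
  apply ax_IPC, IPC_S.
Qed.

Lemma entails_refl X G : G ⊢[X] G.
Proof.
  eapply (entails_mp _ _ (G ⟶ G)); apply ax_IPC, IPC_K.
Qed.

Lemma entails_cut X G A B : G ⊢[X] A -> A ⊢[X] B -> G ⊢[X] B.
Proof.
  intros HA HAB. eapply entails_mp; [|exact HA]. now apply entails_theorem.
Qed.

Lemma entails_and X G A B : G ⊢[X] A -> G ⊢[X] B -> G ⊢[X] (A ⩑ B).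
Proof.
  intros HA HB. eapply entails_mp; [|exact HB]. eapply entails_cut; [exact HA|].
  apply ax_IPC, IPC_andI.
Qed.

Lemma entails_fst X G A B : G ⊢[X] (A ⩑ B) -> G ⊢[X] A.
Proof.
  intros HAB. eapply entails_cut; [exact HAB|]. apply ax_IPC, IPC_andE1.
Qed.

Lemma entails_snd X G A B : G ⊢[X] (A ⩑ B) -> G ⊢[X] B.
Proof.
  intros HAB. eapply entails_cut; [exact HAB|]. apply ax_IPC, IPC_andE2.
Qed.

Lemma entails_hyp X G A : (G ⩑ A) ⊢[X] A.
Proof.
  apply ax_IPC, IPC_andE2.
Qed.

Lemma entails_weaken X G A B : G ⊢[X] B -> (G ⩑ A) ⊢[X] B.
Proof.
  intros HB. eapply entails_cut; [|exact HB]. apply ax_IPC, IPC_andE1.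
Qed.

Lemma entails_intro X G A B : (G ⩑ A) ⊢[X] B -> G ⊢[X] (A ⟶ B).
Proof.
  intros HB. apply entails_mp with (A ⟶ G ⩑ A).
  - eapply entails_mp; [apply entails_theorem, ax_IPC, IPC_S|].
    now apply entails_theorem, entails_theorem.
  - apply ax_IPC, IPC_andI.
Qed.

Lemma entails_trans X G A B C :
  G ⊢[X] (A ⟶ B) -> G ⊢[X] (B ⟶ C) -> G ⊢[X] (A ⟶ C).
Proof.
  intros HAB HBC. apply entails_intro.
  eapply entails_mp; [apply entails_weaken, HBC|].
  eapply entails_mp; [apply entails_weaken, HAB|]. apply entails_hyp.
Qed.

Lemma and_mono X G A A' B B' :
  G ⊢[X] (A ⟶ A') -> G ⊢[X] (B ⟶ B') -> G ⊢[X] (A ⩑ B ⟶ A' ⩑ B').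
Proof.
  intros HA HB. apply entails_intro, entails_and.
  - eapply entails_mp; [apply entails_weaken, HA|].
    eapply entails_fst, entails_hyp.
  - eapply entails_mp; [apply entails_weaken, HB|].
    eapply entails_snd, entails_hyp.
Qed.

Lemma or_mono X G A A' B B' :
  G ⊢[X] (A ⟶ A') -> G ⊢[X] (B ⟶ B') -> G ⊢[X] (A ⩒ B ⟶ A' ⩒ B').
Proof.
  intros HA HB. eapply entails_mp.
  - eapply entails_mp; [apply entails_theorem, ax_IPC, IPC_orE|].
    eapply entails_trans; [exact HA|]. apply entails_theorem, ax_IPC, IPC_orI1.
  - eapply entails_trans; [exact HB|]. apply entails_theorem, ax_IPC, IPC_orI2.
Qed.

Lemma imp_mono X G A A' B B' :
  G ⊢[X] (A' ⟶ A) -> G ⊢[X] (B ⟶ B') -> G ⊢[X] ((A ⟶ B) ⟶ (A' ⟶ B')).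
Proof.
  intros HA HB. apply entails_intro.
  eapply entails_trans; [apply entails_weaken, HA|].
  eapply entails_trans; [apply entails_hyp|]. now apply entails_weaken.
Qed.

Lemma iff_sym X A B : (A ⟷ B) ⊢[X] (B ⟷ A).
Proof.
  apply entails_and; [eapply entails_snd | eapply entails_fst]; apply entails_refl.
Qed.

(** * Strict implication *)

Lemma entails_strict_trans X G A B C :
  G ⊢[X] (A ~> B) -> G ⊢[X] (B ~> C) -> G ⊢[X] (A ~> C).
Proof.
  intros HAB HBC. eapply entails_cut; [apply entails_and; [exact HAB | exact HBC]|].
  apply ax_strict, strict_trans.
Qed.

Lemma box_mono X A B : A ⊢[X] B -> □ A ⊢[X] □ B.
Proof.
  intros HAB. eapply entails_strict_trans; [apply entails_refl|].
  now apply entails_theorem, Nec.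
Qed.

(** [A] strictly implies [Top], hence the boxed [A ⟶ B]; it also strictly implies
    itself, and the conjunction of the two entails [B]. *)
Lemma strict_of_box_imp X G A B : G ⊢[X] □ (A ⟶ B) -> G ⊢[X] (A ~> B).
Proof.
  intros Hbox. apply entails_strict_trans with ((A ⟶ B) ⩑ A).
  - eapply entails_cut; [apply entails_and|apply ax_strict, strict_and].
    + apply entails_strict_trans with Top; [|exact Hbox].
      apply entails_theorem, Nec, entails_theorem, ax_IPC, IPC_topI.
    + apply entails_theorem, Nec, entails_refl.
  - apply entails_theorem, Nec.
    eapply entails_mp; [apply entails_weaken, entails_refl|]. apply entails_hyp.
Qed.

Lemma strict_mono X G A A' B B' :
  G ⊢[X] □ (A' ⟶ A) -> G ⊢[X] □ (B ⟶ B') ->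
  G ⊢[X] ((A ~> B) ⟶ (A' ~> B')).
Proof.
  intros HA HB. apply entails_intro.
  eapply entails_strict_trans; [apply entails_weaken, strict_of_box_imp, HA|].
  eapply entails_strict_trans; [apply entails_hyp|].
  apply entails_weaken, strict_of_box_imp, HB.
Qed.

(** * Consequences of the strong Löb axiom *)

Lemma strong_Loeb_rule G A :
  (G ⩑ □ A) ⊢[strong_Loeb_axiom] A -> G ⊢[strong_Loeb_axiom] A.
Proof.
  intros HA. eapply entails_mp; [apply entails_theorem, ax_extra, strong_Loeb|].
  now apply entails_intro.
Qed.

(** The strong Löb rule is applied to [A ⩑ □ A] rather than to [□ A]: the box of
    this conjunction supplies the second conjunct, the hypothesis the first. *)
Lemma completeness A : A ⊢[strong_Loeb_axiom] □ A.
Proof.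
  apply entails_snd with A, strong_Loeb_rule, entails_and.
  - apply entails_weaken, entails_refl.
  - eapply entails_cut; [apply entails_hyp|].
    eapply box_mono, entails_fst, entails_refl.
Qed.

Lemma entails_box G A : G ⊢[strong_Loeb_axiom] A -> G ⊢[strong_Loeb_axiom] □ A.
Proof.
  intros HA. eapply entails_cut; [apply completeness|]. now apply box_mono.
Qed.

(** * Replacement of equivalents *)

(** Positions under [~>] are reached because, by completeness, whatever follows
    from [G] does so with a box in front. *)
Lemma subst_mono G r C phi psi :
  G ⊢[strong_Loeb_axiom] (phi ⟶ psi) -> G ⊢[strong_Loeb_axiom] (psi ⟶ phi) ->
  G ⊢[strong_Loeb_axiom] (C[r : phi] ⟶ C[r : psi]).
Proof.
  revert phi psi.
  induction C as [p| | |A IHA B IHB|A IHA B IHB|A IHA B IHB|A IHA B IHB];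
    cbn; intros phi psi H1 H2.
  - destruct (Nat.eqb p r); [exact H1|]. apply entails_theorem, entails_refl.
  - apply entails_theorem, entails_refl.
  - apply entails_theorem, entails_refl.
  - apply and_mono; auto.
  - apply or_mono; auto.
  - apply imp_mono; auto.
  - apply strict_mono; apply entails_box; auto.
Qed.

(** Under a [~>] the boxed equivalence suffices: [subst_mono] is applied with the
    equivalence itself as context, and its conclusion is then boxed. *)
Lemma subst_modalised_mono G r chi phi psi :
  modalised r chi -> G ⊢[strong_Loeb_axiom] □ (phi ⟷ psi) ->
  G ⊢[strong_Loeb_axiom] (chi[r : phi] ⟶ chi[r : psi]).
Proof.
  revert phi psi.
  induction chi as [p| | |A IHA B IHB|A IHA B IHB|A IHA B IHB|A _ B _];
    cbn; intros phi psi Hmod Hbox.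
  - apply Nat.eqb_neq in Hmod. rewrite Hmod. apply entails_theorem, entails_refl.
  - apply entails_theorem, entails_refl.
  - apply entails_theorem, entails_refl.
  - destruct Hmod. apply and_mono; auto.
  - destruct Hmod. apply or_mono; auto.
  - destruct Hmod. apply imp_mono; [|now auto].
    apply IHA; [assumption|]. eapply entails_cut; [exact Hbox|].
    apply box_mono, iff_sym.
  - apply strict_mono; (eapply entails_cut; [exact Hbox|]);
      apply box_mono, subst_mono;
      first [eapply entails_fst, entails_refl | eapply entails_snd, entails_refl].
Qed.

(** * Strong uniqueness of modalised fixed points *)

Theorem theorem3p6 (r : nat) (chi : form) (Hchi : modalised r chi) (phi psi : form) :
  iSLa ((phi ⟷ chi[r : phi]) ⩑ (psi ⟷ chi[r : psi]) ⟶ (phi ⟷ psi)).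
Proof.
  apply strong_Loeb_rule.
  set (G := _ ⩑ □ (phi ⟷ psi)).
  assert (Hphi : iSLa (G ⟶ (phi ⟷ chi[r : phi]))).
  { eapply entails_weaken, entails_fst, entails_refl. }
  assert (Hpsi : iSLa (G ⟶ (psi ⟷ chi[r : psi]))).
  { eapply entails_weaken, entails_snd, entails_refl. }
  assert (Hbox : iSLa (G ⟶ □ (phi ⟷ psi))) by apply entails_hyp.
  apply entails_and.
  - eapply entails_trans; [eapply entails_fst, Hphi|].
    eapply entails_trans; [now apply subst_modalised_mono, Hbox|].
    eapply entails_snd, Hpsi.
  - eapply entails_trans; [eapply entails_fst, Hpsi|].
    eapply entails_trans; [|eapply entails_snd, Hphi].
    apply subst_modalised_mono; [exact Hchi|].
    eapply entails_cut; [exact Hbox|]. apply box_mono, iff_sym.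
Qed.
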